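(* A permutation $\pi$ is DI-sortable if and only if $\pi$ avoids both patterns $3142$ and $3241$. Equivalently, the basis of the class of DI-sortable permutations is $\{3142,3241\}$.
   Context: The DI machine consists of two stacks in series: a decreasing stack D followed by an increasing stack I. A permutation $\pi=\pi(1)\cdots\pi(n)$ is processed from left to right, and the allowed moves are: push the next unread input entry onto the top of D; move the top entry of D onto the top of I; move the top entry of I to the end of the output. The entries of D must be decreasing when read from top to bottom (an entry may be placed on D only if it exceeds D's current top entry, or D is empty), and the entries of I must be increasing when read from top to bottom (an entry may be placed on I only if it is smaller than I's current top entry, or I is empty). A permutation $\pi$ of length $n$ is DI-sortable if some sequence of legal moves empties the input and both stacks and produces the output $12\cdots n$. A permutation $\pi$ contains a pattern $\sigma$ of length $k$ if some subsequence of $\pi$ of length $k$ is order-isomorphic to $\sigma$; otherwise $\pi$ avoids $\sigma$. The basis of a permutation class is the set of minimal permutations (under pattern containment) not in the class. *)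

(* Defs.v *)
From mathcomp Require Import all_boot.
From Stdlib Require Export Relation_Operators.

Set Implicit Arguments.
Unset Strict Implicit.
Unset Printing Implicit Defensive.

(* Permutations of every length live in [seq nat], in one-line notation with
   values 1, ..., n, so that pattern containment can relate different lengths. *)
Definition permutation (pi : seq nat) : bool := perm_eq pi (iota 1 (size pi)).

Definition order_isomorphic (s t : seq nat) : Prop :=
  size s = size t /\
  forall i j : nat, i < size s -> j < size s ->
    (nth 0 s i < nth 0 s j) = (nth 0 t i < nth 0 t j).

Definition contains (pi sigma : seq nat) : Prop :=
  exists2 s : seq nat, subseq s pi & order_isomorphic s sigma.

Definition avoids (pi sigma : seq nat) : Prop := ~ contains pi sigma.

Definition basis (C : seq nat -> Prop) (sigma : seq nat) : Prop :=
  [/\ permutation sigma, ~ C sigma &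
      forall tau : seq nat, permutation tau -> ~ C tau ->
        contains sigma tau -> tau = sigma].

(* The head of [input] is the next unread entry, the head of a stack is its top,
   and [output] lists the entries in the order in which they were output. *)
Record config := Config {
  input : seq nat;
  stackD : seq nat;
  stackI : seq nat;
  output : seq nat
}.

Definition fitsD (x : nat) (D : seq nat) : bool :=
  if D is y :: _ then y < x else true.

Definition fitsI (x : nat) (I : seq nat) : bool :=
  if I is y :: _ then x < y else true.

Inductive DI_move : config -> config -> Prop :=
| Move_input_D x inp D I out : fitsD x D ->
    DI_move (Config (x :: inp) D I out) (Config inp (x :: D) I out)
| Move_D_I x inp D I out : fitsI x I ->
    DI_move (Config inp (x :: D) I out) (Config inp D (x :: I) out)
| Move_I_output x inp D I out :
    DI_move (Config inp D (x :: I) out) (Config inp D I (rcons out x)).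

Definition DI_sortable (pi : seq nat) : Prop :=
  clos_refl_trans_1n config DI_move
    (Config pi [::] [::] [::])
    (Config [::] [::] [::] (iota 1 (size pi))).

(* Main.v *)
Require Import Defs.
From mathcomp Require Import all_boot.
From mathcomp Require Import zify.

(** Both patterns have the form [c a d b] with [a, b < c < d].  Such entries
    block the machine: [a] can enter D only after [c] has moved to I, and [b] can
    enter D only after [d] has moved to I, but [d] cannot be put above [c] while
    [c] waits in I for the smaller [b] to be output.  Conversely, if no such
    entries exist, the following strategy keeps the contents of D, read from
    bottom to top, followed by those of I, read from top to bottom, increasing.
    Before an entry [x] is read, if [x] exceeds some entry of I then all of D is
    moved to I and everything below [x] is output; otherwise the entries of D
    above [x] are moved to I. *)

Set Implicit Arguments.
Unset Strict Implicit.
Unset Printing Implicit Defensive.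

(** * Reachability, and blocking quadruples in place of the two patterns *)

Notation reach := (clos_refl_trans_1n config DI_move).

Lemma reach_trans x y z : reach x y -> reach y z -> reach x z.
Proof. by elim=> // {}x u v xu _ IH /IH; apply: rt1n_trans. Qed.

Lemma reach_step x y : DI_move x y -> reach x y.
Proof. by move=> xy; apply: rt1n_trans xy _; apply: rt1n_refl. Qed.

Definition blocking (c a d b : nat) : bool := [&& a < c, b < c & c < d].

Lemma order_isomorphic_3142 s : order_isomorphic s [:: 3; 1; 4; 2] <->
  exists c a d b, s = [:: c; a; d; b] /\ [&& a < b, b < c & c < d].
Proof.
split=> [[]|[c [a [d [b [-> lts]]]]]].
  case: s => [|c [|a [|d [|b [|? ?]]]]] //= _ iso; exists c, a, d, b; split=> //.
  by rewrite (iso 1 3) // (iso 3 0) // (iso 0 2).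
by split=> // [[|[|[|[|i]]]] [|[|[|[|j]]]]] //= _ _; lia.
Qed.

Lemma order_isomorphic_3241 s : order_isomorphic s [:: 3; 2; 4; 1] <->
  exists c a d b, s = [:: c; a; d; b] /\ [&& b < a, a < c & c < d].
Proof.
split=> [[]|[c [a [d [b [-> lts]]]]]].
  case: s => [|c [|a [|d [|b [|? ?]]]]] //= _ iso; exists c, a, d, b; split=> //.
  by rewrite (iso 3 1) // (iso 1 0) // (iso 0 2).
by split=> // [[|[|[|[|i]]]] [|[|[|[|j]]]]] //= _ _; lia.
Qed.

(** The patterns differ only in the relative order of their second and last entries. Since [pi] has
    no repetitions, a blocking quadruple satisfies [a < b] or [b < a], and each case gives one
    pattern. *)
Lemma avoids_blocking pi : uniq pi ->
  (avoids pi [:: 3; 1; 4; 2] /\ avoids pi [:: 3; 2; 4; 1]) <->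
  (forall c a d b, blocking c a d b -> ~~ subseq [:: c; a; d; b] pi).
Proof.
move=> uniq_pi; split=> [[av1 av2] c a d b /and3P[ac bc cd]|noblock].
  apply/negP=> sub; have := subseq_uniq sub uniq_pi => /= uniq_s.
  have /orP[ab|ba] : (a < b) || (b < a).
  - by move: uniq_s; rewrite !inE; lia.
  - apply: av1; exists [:: c; a; d; b] => //; apply/order_isomorphic_3142.
    by exists c, a, d, b; rewrite ab bc cd.
  - apply: av2; exists [:: c; a; d; b] => //; apply/order_isomorphic_3241.
    by exists c, a, d, b; rewrite ba ac cd.
split=> -[s sub iso]; move: sub.
- have [c [a [d [b [-> lts]]]]] := (order_isomorphic_3142 s).1 iso.
  by apply/negP/noblock; rewrite /blocking; lia.
- have [c [a [d [b [-> lts]]]]] := (order_isomorphic_3241 s).1 iso.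
  by apply/negP/noblock; rewrite /blocking; lia.
Qed.

(** * Necessity: a blocking quadruple obstructs every run of the machine *)

Definition wf (x : config) : bool := sorted gtn (stackD x) && sorted ltn (stackI x).

Lemma gtn_trans : transitive gtn.
Proof. by move=> y x z /= yx zy; apply: ltn_trans zy yx. Qed.

(** The type [config] does not impose ordered stacks, and a push is compared with the top entry
    only; this invariant turns that comparison into a bound on the whole stack. *)
Lemma wf_move x y : DI_move x y -> wf x -> wf y.
Proof.
rewrite /wf; case=> {x y} [x inp D I out|x inp D I out|x inp D I out] /=.
- by case: D => //= y D -> /=.
- by move=> fits /andP[/path_sorted-> /=]; case: I fits => //= y I ->.
- by move=> /andP[-> /path_sorted].
Qed.

Lemma fitsD_lt x D y : sorted gtn D -> fitsD x D -> y \in D -> y < x.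
Proof.
case: D => //= z D; rewrite (path_sortedE gtn_trans) => /andP[/allP ltz _] zx.
by rewrite inE => /predU1P[->//|/ltz/= yz]; apply: ltn_trans zx.
Qed.

Lemma fitsI_lt x I y : sorted ltn I -> fitsI x I -> y \in I -> x < y.
Proof.
case: I => //= z I; rewrite (path_sortedE ltn_trans) => /andP[/allP ltz _] xz.
by rewrite inE => /predU1P[->//|/ltz/= zy]; apply: ltn_trans zy.
Qed.

(* The successive stages of the obstruction caused by a blocking quadruple. *)
Inductive stuck (c a d b : nat) (x : config) : Prop :=
| Stuck_unread of subseq [:: c; a; d; b] (input x)
| Stuck_c_in_D of c \in stackD x & subseq [:: a; d; b] (input x)
| Stuck_c_in_I of c \in stackI x & subseq [:: d; b] (input x)
| Stuck_d_in_D of c \in stackI x & d \in stackD x & b \in input x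
| Stuck_c_output of c \in output x & b \in input x ++ stackD x ++ stackI x
| Stuck_cb_output of subseq [:: c; b] (output x).

Lemma subseq_cons2 (a x : nat) s t :
  subseq (a :: s) (x :: t) -> a = x /\ subseq s t \/ subseq (a :: s) t.
Proof. by rewrite /=; case: eqP => [->|_]; [left|right]. Qed.

Lemma subseq_rcons2 (c b x : nat) s :
  subseq [:: c; b] s || (c \in s) && (x == b) -> subseq [:: c; b] (rcons s x).
Proof.
case/orP=> [sub|/andP[cs /eqP->]].
  by apply: subseq_trans sub (subseq_rcons _ _).
by rewrite -cats1 -[[:: c; b]]/([:: c] ++ [:: b]) cat_subseq // sub1seq ?inE.
Qed.

(** Each move keeps the current stage or passes to a later one. The moves that would escape are
    illegal: pushing [a] while [c] is in D, pushing [b] while [d] is in D, and moving [d] to I while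
    [c] is there. *)
Lemma stuck_move c a d b x y : blocking c a d b -> wf x ->
  DI_move x y -> stuck c a d b x -> stuck c a d b y.
Proof.
move=> /and3P[ac bc cd] wfx mv st; case: mv wfx st => {x y}.
- move=> x inp D I out fits /andP[/= sD sI].
  case=> /= [/subseq_cons2[[-> sub]|sub]|cD /subseq_cons2[[ax sub]|sub]
            |cI /subseq_cons2[[dx sub]|sub]|cI dD|co|cb].
  + by apply: Stuck_c_in_D; rewrite //= mem_head.
  + by apply: Stuck_unread.
  + by have := fitsD_lt sD fits cD; lia.
  + by apply: Stuck_c_in_D; rewrite //= inE cD orbT.
  + by apply: Stuck_d_in_D; rewrite //= ?dx ?mem_head // -sub1seq.
  + by apply: Stuck_c_in_I.
  + rewrite inE => /predU1P[bx|b_inp].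
      by have := fitsD_lt sD fits dD; lia.
    by apply: Stuck_d_in_D; rewrite //= inE dD orbT.
  + by move=> b_rest; apply: Stuck_c_output; move: b_rest; rewrite //= !(inE, mem_cat); lia.
  + by apply: Stuck_cb_output.
- move=> x inp D I out fits /andP[/= sD sI].
  case=> /= [sub|cD sub|cI sub|cI dD b_inp|co|cb].
  + by apply: Stuck_unread.
  + move: cD; rewrite inE => /predU1P[cx|cD]; last exact: Stuck_c_in_D.
    apply: Stuck_c_in_I; rewrite /= ?cx ?mem_head //.
    exact: subseq_trans (subseq_cons _ _) sub.
  + by apply: Stuck_c_in_I; rewrite //= inE cI orbT.
  + move: dD; rewrite inE => /predU1P[dx|dD].
      by have := fitsI_lt sI fits cI; lia.
    by apply: Stuck_d_in_D; rewrite //= inE cI orbT.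
  + by move=> b_rest; apply: Stuck_c_output; move: b_rest; rewrite //= !(inE, mem_cat); lia.
  + by apply: Stuck_cb_output.
- move=> x inp D I out _.
  (* If [c] leaves I while [b] is unread, then [c] is output before [b]. *)
  have c_output : c \in x :: I -> b \in inp ->
      c \in I \/ stuck c a d b (Config inp D I (rcons out x)).
    rewrite inE => /predU1P[->|cI] b_inp; [right|by left].
    by apply: Stuck_c_output; rewrite /= ?mem_rcons ?mem_head // mem_cat b_inp.
  case=> /= [sub|cD sub|cI sub|cI dD b_inp|co|cb].
  + by apply: Stuck_unread.
  + by apply: Stuck_c_in_D.
  + have b_inp : b \in inp by apply: (mem_subseq sub); rewrite !inE eqxx orbT.
    by have [{}cI|//] := c_output cI b_inp; apply: Stuck_c_in_I.
  + by have [{}cI|//] := c_output cI b_inp; apply: Stuck_d_in_D.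
  + rewrite !mem_cat inE => b_rest; have [bx|bx] := eqVneq b x.
      by apply/Stuck_cb_output/subseq_rcons2; rewrite co bx eqxx orbT.
    apply: Stuck_c_output; rewrite /= ?mem_rcons ?inE ?co ?orbT // !mem_cat.
    by move: b_rest; rewrite (negPf bx).
  + by apply/Stuck_cb_output/subseq_rcons2; rewrite cb.
Qed.

Lemma stuck_reach c a d b x y : blocking c a d b -> wf x ->
  reach x y -> stuck c a d b x -> stuck c a d b y.
Proof.
move=> block + xy; elim: xy => // {}x u v xu _ IH wfx st.
by apply: IH (wf_move xu wfx) _; apply: stuck_move st.
Qed.

Lemma sortable_noblock pi c a d b : DI_sortable pi -> blocking c a d b ->
  ~~ subseq [:: c; a; d; b] pi.
Proof.
move=> srt block; apply/negP=> sub.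
have st : stuck c a d b (Config pi [::] [::] [::]) by apply: Stuck_unread.
(* With the input and both stacks empty, only [Stuck_cb_output] survives; the sorted output then
   forces [c < b]. *)
have [] // := stuck_reach block _ srt st.
move=> /= /(subseq_sorted ltn_trans)/(_ (iota_ltn_sorted _ _)) /=.
by case/and3P: block; lia.
Qed.

(** * Sufficiency: the sorting strategy *)

Lemma sorted_ltn_cat s t :
  sorted ltn (s ++ t) = [&& allrel ltn s t, sorted ltn s & sorted ltn t].
Proof. by rewrite !(sorted_pairwise ltn_trans) pairwise_cat. Qed.

(** Here [L1 ++ L2] is D read from bottom to top, so [L2] crosses starting from its last entry and
    keeps its order on I. Sortedness makes each push legal. *)
Lemma reach_D_to_I L1 L2 R inp out : sorted ltn (L2 ++ R) ->
  reach (Config inp (rev (L1 ++ L2)) R out) (Config inp (rev L1) (L2 ++ R) out).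
Proof.
elim/last_ind: L2 R => [|L2 x IH] R; first by rewrite cats0 => _; apply: rt1n_refl.
rewrite cat_rcons -rcons_cat rev_rcons => lt_sorted.
apply: reach_trans (IH _ lt_sorted); apply/reach_step/Move_D_I.
by move: lt_sorted; rewrite sorted_ltn_cat; case: R => //= y R /and4P[].
Qed.

Lemma reach_I_output L R inp D out :
  reach (Config inp D (L ++ R) out) (Config inp D R (out ++ L)).
Proof.
elim: L out => [|x L IH] out; first by rewrite cats0; apply: rt1n_refl.
by rewrite -cat_rcons; apply: reach_trans (IH _); apply/reach_step/Move_I_output.
Qed.

(** Reading [x] splits the waiting entries: in one case of the strategy [s1] is output and [s2] is
    left in I, in the other [s1] stays in D and [s2] moves to I. *)
Lemma sorted_ltn_split x s : sorted ltn s -> x \notin s ->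
  exists s1 s2, s = s1 ++ s2 /\ sorted ltn (s1 ++ x :: s2).
Proof.
elim: s => [|y s IH]; first by exists [::], [::].
rewrite inE negb_or neq_ltn /= => y_s /andP[/orP[xy|yx] x_s].
  by exists [::], (y :: s); rewrite /= xy.
have [s1 [s2 [def_s lt_sorted]]] := IH (path_sorted y_s) x_s.
exists (y :: s1), s2; split; first by rewrite def_s.
move: y_s; rewrite /= !(path_sortedE ltn_trans) lt_sorted def_s !all_cat /= andbT.
by rewrite yx => /andP[].
Qed.

Lemma sort_ltn_cat s1 s2 : sorted ltn s1 -> allrel leq s1 s2 ->
  sort leq (s1 ++ s2) = s1 ++ sort leq s2.
Proof.
move=> s1_sorted s12; apply: (sorted_eq leq_trans anti_leq).
- exact: sort_sorted leq_total _.
- rewrite (sorted_pairwise leq_trans) pairwise_cat -!(sorted_pairwise leq_trans).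
  rewrite (sub_sorted _ s1_sorted) => [|a b /ltnW//].
  rewrite (sort_sorted leq_total) /= andbT.
  by apply/allrelP=> a b a_s1; rewrite mem_sort; apply: (allrelP s12).
- by rewrite perm_sort perm_cat2l perm_sym perm_sort.
Qed.

Lemma nsubseq_behead (x : nat) s t : ~~ subseq s (x :: t) -> ~~ subseq s t.
Proof. by apply: contra => /subseq_trans; apply; apply: subseq_cons. Qed.

(** Induction on the input, with [L] for D from bottom to top and [R] for I from top to bottom. The
    last three hypotheses exclude the first three stages of [stuck]: [c] unread, in D, or in I. *)
Lemma reach_sorted inp L R out :
  sorted ltn (L ++ R) -> uniq (inp ++ L ++ R) ->
  (forall c a d b, blocking c a d b -> ~~ subseq [:: c; a; d; b] inp) ->
  (forall c a d b, blocking c a d b -> c \in L -> ~~ subseq [:: a; d; b] inp) ->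
  (forall c d b, b < c < d -> c \in R -> ~~ subseq [:: d; b] inp) ->
  reach (Config inp (rev L) R out)
        (Config [::] [::] [::] (out ++ sort leq (inp ++ L ++ R))).
Proof.
elim: inp L R out => [|x inp IH] L R out LR_sorted LR_uniq free freeL freeR.
  apply: reach_trans (reach_D_to_I [::] _ _ LR_sorted) _.
  rewrite sorted_sort ?(sub_sorted _ LR_sorted) //; last by move=> a b /ltnW.
    by rewrite -{1}[L ++ R]cats0; apply: reach_I_output.
  exact: leq_trans.
have xLR : x \notin L ++ R by move: LR_uniq; rewrite /= mem_cat negb_or => /andP[/andP[]].
have free' c a d b : blocking c a d b -> ~~ subseq [:: c; a; d; b] inp.
  by move/free/nsubseq_behead.
have freex a d b : blocking x a d b -> ~~ subseq [:: a; d; b] inp.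
  by move/free; rewrite /= eqxx.
have freeL' c a d b : blocking c a d b -> c \in L -> ~~ subseq [:: a; d; b] inp.
  by move=> block /(freeL _ _ _ _ block)/nsubseq_behead.
(* An entry [c] of D exceeding [x] may go to I: [x] plays the role of [a], so [freeL] yields the
   stronger condition required of entries of I. *)
have freeLR c d b : b < c < d -> c \in L ++ R -> x < c -> ~~ subseq [:: d; b] inp.
  move=> bcd; rewrite mem_cat => /orP[cL|cR] xc.
    by have := freeL c x d b; rewrite /blocking xc bcd cL /= eqxx; apply.
  by apply: contra (freeR _ _ _ bcd cR) => /subseq_trans; apply; apply: subseq_cons.
have [/hasP[s sR /= sx]|/hasPn R_gt] := boolP (has (ltn^~ x) R).
- have [J1 [J2 [def_J J_sorted]]] := sorted_ltn_split LR_sorted xLR.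
  move: (J_sorted); rewrite sorted_ltn_cat => /and3P[/allrelP J1_lt J1_sorted xJ2_sorted].
  apply: reach_trans (reach_D_to_I [::] _ _ LR_sorted) _.
  rewrite def_J; apply: reach_trans (reach_I_output _ _ _ _ _) _.
  apply: reach_trans (reach_step (Move_input_D _ _ _ _)) _ => //.
  have perm_J1 : perm_eq ((x :: inp) ++ J1 ++ J2) (J1 ++ inp ++ [:: x] ++ J2).
    by apply/permP=> p; rewrite /= !count_cat /=; lia.
  (* Outputting [J1] now is correct provided nothing that remains is smaller than an entry of
     [J1]. *)
  have -> : sort leq ((x :: inp) ++ J1 ++ J2) = J1 ++ sort leq (inp ++ [:: x] ++ J2).
    rewrite -sort_ltn_cat //.
      exact/(perm_sortP leq_total leq_trans anti_leq).
    apply/allrelP=> u v uJ1; rewrite catA mem_cat => /orP[|vJ2].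
    + rewrite mem_cat inE => /orP[v_inp|/eqP->]; last exact/ltnW/J1_lt/mem_head.
      have ux : u < x by apply/J1_lt/mem_head.
      have [w [wR wx uw]] : exists w, [/\ w \in R, w < x & u <= w].
        have : u \in L ++ R by rewrite def_J mem_cat uJ1.
        rewrite mem_cat => /orP[uL|uR]; last by exists u.
        exists s; split=> //; apply: ltnW.
        by move: LR_sorted; rewrite sorted_ltn_cat => /and3P[/allrelP + _ _]; apply.
      rewrite leqNgt; apply/negP=> vu.
      have := freeR w x v; rewrite wx (leq_trans vu uw) wR /= eqxx sub1seq v_inp.
      by move=> /(_ isT isT).
    + by apply/ltnW/J1_lt; rewrite ?inE ?vJ2 ?orbT.
  rewrite (catA out J1); apply: (IH [:: x]) => //.
  + by move: LR_uniq; rewrite def_J (perm_uniq perm_J1) cat_uniq => /and3P[].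
  + by move=> c a d b block; rewrite inE => /eqP cx; apply: freex; rewrite -cx.
  + move=> c d b bcd cJ2; apply: (freeLR c) => //; first by rewrite def_J mem_cat cJ2 orbT.
    move: xJ2_sorted => /=; rewrite (path_sortedE ltn_trans) => /andP[/allP + _].
    exact.
- move: (LR_sorted); rewrite sorted_ltn_cat => /and3P[/allrelP L_lt L_sorted R_sorted].
  have xL : x \notin L by move: xLR; rewrite mem_cat negb_or => /andP[].
  have [J1 [J2 [def_L J_sorted]]] := sorted_ltn_split L_sorted xL.
  (* The next configuration has [rcons J1 x] in D and [J2 ++ R] in I. *)
  have J_R_sorted : sorted ltn (rcons J1 x ++ J2 ++ R).
    rewrite cat_rcons -cat_cons catA sorted_ltn_cat J_sorted R_sorted !andbT.
    apply/allrelP=> u v; rewrite mem_cat inE orbCA -mem_cat -def_L.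
    move=> /predU1P[-> vR|]; last exact: L_lt.
    have := R_gt v vR; have : x != v by apply: contraNneq xLR => ->; rewrite mem_cat vR orbT.
    by rewrite /=; lia.
  rewrite def_L; apply: reach_trans (reach_D_to_I _ _ _ _) _.
    by move: J_R_sorted; rewrite sorted_ltn_cat => /and3P[].
  apply: reach_trans (reach_step (Move_input_D _ _ _ _)) _.
    case/lastP: J1 J_sorted {def_L J_R_sorted} => // J1 y.
    by rewrite rev_rcons cat_rcons sorted_cat_cons /= => /and3P[].
  rewrite -rev_rcons.
  have perm_x : perm_eq ((x :: inp) ++ (J1 ++ J2) ++ R) (inp ++ rcons J1 x ++ J2 ++ R).
    by apply/permP=> p; rewrite -cats1 /= !count_cat /=; lia.
  rewrite ((perm_sortP leq_total leq_trans anti_leq _ _) perm_x).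
  apply: IH => //.
  + by move: LR_uniq; rewrite def_L (perm_uniq perm_x).
  + move=> c a d b block; rewrite mem_rcons inE => /predU1P[cx|cJ1].
      by apply: freex; rewrite -cx.
    by apply: (freeL' c) => //; rewrite def_L mem_cat cJ1.
  + move=> c d b bcd c_J2R; apply: (freeLR c) => //.
      by rewrite def_L -catA mem_cat c_J2R orbT.
    move: J_R_sorted; rewrite sorted_ltn_cat => /and3P[/allrelP/(_ x c) + _ _].
    by apply; rewrite // mem_rcons mem_head.
Qed.

Lemma DI_sortable_avoids pi : permutation pi ->
  DI_sortable pi <-> avoids pi [:: 3; 1; 4; 2] /\ avoids pi [:: 3; 2; 4; 1].
Proof.
move=> perm_pi; have uniq_pi : uniq pi by rewrite (perm_uniq perm_pi) iota_uniq.
split=> [srt|/(avoids_blocking uniq_pi) noblock].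
  by apply/(avoids_blocking uniq_pi) => c a d b; apply: sortable_noblock.
(* The target output is the sorted list of the entries, because [pi] is a permutation. *)
have -> : DI_sortable pi = reach (Config pi (rev [::]) [::] [::])
    (Config [::] [::] [::] ([::] ++ sort leq (pi ++ [::] ++ [::]))).
  rewrite /DI_sortable /= cats0; congr (reach _ (Config _ _ _ _)).
  apply: (sorted_eq leq_trans anti_leq) => //.
  - exact: iota_sorted.
  - exact: sort_sorted leq_total _.
  - by rewrite perm_sym perm_sort.
by apply: reach_sorted; rewrite ?cats0.
Qed.

(** * The basis *)

Lemma permutation_bounds pi : permutation pi -> all (fun x => 0 < x <= size pi) pi.
Proof.
move=> perm_pi; apply/allP=> x.
by rewrite (perm_mem perm_pi) mem_iota add1n ltnS.
Qed.

Lemma contains_size s t : contains s t -> size t <= size s.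
Proof. by case=> u /size_subseq le_us [<- _]. Qed.

Lemma contains_same_size s t : contains s t -> size s = size t -> order_isomorphic s t.
Proof.
by case=> u sub iso eq_st; have/eqP <- : u == s by rewrite -(size_subseq_leqif sub) iso.1 eq_st.
Qed.

(** Four strictly increasing values between 1 and 4 can only be 1, 2, 3, 4. *)
Lemma permutation_iso_3142 pi : permutation pi ->
  order_isomorphic pi [:: 3; 1; 4; 2] -> pi = [:: 3; 1; 4; 2].
Proof.
move=> + /order_isomorphic_3142[c [a [d [b [def_pi lts]]]]].
rewrite def_pi => /permutation_bounds /= bounds.
by congr [:: _; _; _; _]; lia.
Qed.

Lemma permutation_iso_3241 pi : permutation pi ->
  order_isomorphic pi [:: 3; 2; 4; 1] -> pi = [:: 3; 2; 4; 1].
Proof.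
move=> + /order_isomorphic_3241[c [a [d [b [def_pi lts]]]]].
rewrite def_pi => /permutation_bounds /= bounds.
by congr [:: _; _; _; _]; lia.
Qed.

Lemma contains_refl s : contains s s.
Proof. by exists s. Qed.

Lemma order_isomorphic_trans s t u :
  order_isomorphic s t -> order_isomorphic t u -> order_isomorphic s u.
Proof.
case=> eq_st iso [eq_tu iso']; split=> [|i j lt_i lt_j]; first by rewrite eq_st.
by rewrite iso // iso' // -eq_st.
Qed.

(** An unsortable [tau] inside [sigma] contains a pattern of length 4, which forces [tau] to have
    length 4 too. Then [sigma] and [tau] are order-isomorphic to the same pattern, hence both equal
    to it. *)
Lemma basis_of_size_4 sigma : permutation sigma -> size sigma = 4 ->
  contains sigma [:: 3; 1; 4; 2] \/ contains sigma [:: 3; 2; 4; 1] ->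
  basis DI_sortable sigma.
Proof.
move=> perm_sigma size_sigma has_pattern.
split=> // [/(DI_sortable_avoids perm_sigma)[av1 av2]|tau perm_tau nsort_tau sigma_tau].
  by case: has_pattern.
have iso p : size p = 4 -> contains tau p -> order_isomorphic sigma p /\ order_isomorphic tau p.
  move=> size_p tau_p; have size_tau : size tau = 4.
    by have := contains_size sigma_tau; have := contains_size tau_p; lia.
  have tau_iso : order_isomorphic tau p by apply: contains_same_size; rewrite ?size_tau.
  split=> //; apply: order_isomorphic_trans tau_iso.
  by apply: contains_same_size; rewrite ?size_tau.
apply/eqP; apply/negPn/negP => tau_sigma; apply: nsort_tau.
apply/(DI_sortable_avoids perm_tau); split=> /iso[] // isos isot; case/negP: tau_sigma.
- by rewrite (permutation_iso_3142 perm_tau) // (permutation_iso_3142 perm_sigma).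
- by rewrite (permutation_iso_3241 perm_tau) // (permutation_iso_3241 perm_sigma).
Qed.

Theorem theorem4 :
  (forall pi : seq nat, permutation pi ->
     (DI_sortable pi <->
      avoids pi [:: 3; 1; 4; 2] /\ avoids pi [:: 3; 2; 4; 1])) /\
  (forall sigma : seq nat,
     basis DI_sortable sigma <->
     sigma = [:: 3; 1; 4; 2] \/ sigma = [:: 3; 2; 4; 1]).
Proof.
split=> [|sigma]; first exact: DI_sortable_avoids.
have basis1 : basis DI_sortable [:: 3; 1; 4; 2].
  by apply: basis_of_size_4 => //; left; apply: contains_refl.
have basis2 : basis DI_sortable [:: 3; 2; 4; 1].
  by apply: basis_of_size_4 => //; right; apply: contains_refl.
split=> [[perm_sigma nsort min]|[] -> //].
case: (sigma =P [:: 3; 1; 4; 2]) => [->|neq1]; first by left.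
case: (sigma =P [:: 3; 2; 4; 1]) => [->|neq2]; first by right.
case: nsort; apply/(DI_sortable_avoids perm_sigma).
(* If [sigma] contained one of the patterns, itself unsortable, minimality would make [sigma] equal
   to it. *)
by case: basis1 basis2 => [perm1 ns1 _] [perm2 ns2 _]; split=> /min-/(_ _ _)/esym; auto.
Qed.
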